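(* Let $\Sigma$ be a finite signature and $\mathcal{T}$ any $\Sigma$-theory. If $L$ is a $\mathcal{T}$-regular $\mathcal{T}$-language, then its Kleene star $L^*$, i.e. the set of $\mathcal{T}$-words $\bar\sigma$ that can be written as a concatenation $\bar\sigma=\bar\sigma_1\cdots\bar\sigma_k$ ($k\ge 0$) with each $\bar\sigma_j\in L$, is $\mathcal{T}$-regular.
   Context: Signatures are multi-sorted first-order signatures in which every symbol is marked either rigid or non-rigid. For a signature $\Sigma$, $\Sigma'$ denotes the signature obtained from $\Sigma$ by replacing each non-rigid symbol $s$ by a fresh primed copy $s'$ (rigid symbols are kept); for a $\Sigma$-structure $\sigma$, $\sigma'$ denotes the corresponding renamed $\Sigma'$-structure. For structures over pairwise disjoint signatures with the same sort domains, $\rho\cup\sigma\cup\tau'$ denotes the combined structure over the union of the signatures. A $\Sigma$-theory $\mathcal{T}$ is a set of $\Sigma$-sentences; $[\![\mathcal{T}]\!]$ is the set of all $\Sigma$-structures with finite or countably infinite domains that satisfy $\mathcal{T}$. A $\mathcal{T}$-word is a finite sequence $\bar\sigma=\langle\sigma_0,\ldots,\sigma_{n-1}\rangle$ ($n\ge 0$) of elements of $[\![\mathcal{T}]\!]$ such that for every sort $S$ and every rigid symbol $s$ of $\Sigma$, $S^{\sigma_i}=S^{\sigma_j}$ and $s^{\sigma_i}=s^{\sigma_j}$ for all $i,j$. $[\![\mathcal{T}]\!]^*$ is the set of all $\mathcal{T}$-words; a $\mathcal{T}$-language is a subset of $[\![\mathcal{T}]\!]^*$. A first-order automaton is a tuple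 $\mathcal{A}=\langle\Sigma,\Gamma,\phi_0,\phi_T,\phi_F\rangle$ where $\Sigma$ (word signature) and $\Gamma$ (state signature) are finite disjoint signatures, $\phi_0$ and $\phi_F$ are first-order $\Gamma$-sentences, and $\phi_T$ is a first-order $(\Gamma\cup\Sigma\cup\Gamma')$-sentence. Given a $\mathcal{T}$-word $\bar\sigma=\langle\sigma_0,\ldots,\sigma_{n-1}\rangle$, a $\mathcal{T}$-run of $\mathcal{A}$ induced by $\bar\sigma$ is a sequence $\langle\rho_0,\ldots,\rho_n\rangle$ of $\Gamma$-structures such that $S^{\rho_i}=S^{\sigma_0}$ for every sort $S$ and every $i$, rigid symbols of $\Gamma$ are interpreted identically in all $\rho_i$, $\rho_0\models\phi_0$, and $\rho_i\cup\sigma_i\cup\rho'_{i+1}\models\phi_T$ for all $0\le i<n$. $\mathcal{A}$ $\mathcal{T}$-accepts $\bar\sigma$ iff some such run satisfies $\rho_n\models\phi_F$. $\mathcal{L}_{\mathcal{T}}(\mathcal{A})$ is the set of $\mathcal{T}$-words $\mathcal{T}$-accepted by $\mathcal{A}$. A $\mathcal{T}$-language $L$ is $\mathcal{T}$-regular iff $L=\mathcal{L}_{\mathcal{T}}(\mathcal{A})$ for some first-order automaton $\mathcal{A}$ with word signature $\Sigma$. *)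

(* Defs.v *)
From mathcomp Require Import all_boot.
From Stdlib Require List.

Set Implicit Arguments.
Unset Strict Implicit.
Unset Printing Implicit Defensive.

(** * Multi-sorted first-order logic with equality *)

(** Signatures are finite.  The sorts form a parameter because the word and
    state signatures of an automaton share them.  Constants are function symbols
    of arity 0. *)
Record signature (S : finType) := Signature {
  fsym : finType;
  psym : finType;
  fun_arity : fsym -> nat;
  fun_args : forall f : fsym, 'I_(fun_arity f) -> S;
  fres : fsym -> S;
  pred_arity : psym -> nat;
  pred_args : forall p : psym, 'I_(pred_arity p) -> S;
  frigid : pred fsym;
  prigid : pred psym }.

Arguments fun_args {S s} f _.
Arguments pred_args {S s} p _.
Arguments frigid {S s} _.
Arguments prigid {S s} _.

Section Syntax.
Variables (S : finType) (Sig : signature S).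

(** A context is a type [V] of variables with their sorts [c : V -> S]. *)
Inductive term (V : Type) (c : V -> S) : S -> Type :=
| Var (v : V) : term c (c v)
| App (f : fsym Sig) (ts : forall i, term c (fun_args f i)) : term c (fres f).

Definition extend (V : Type) (c : V -> S) (s : S) : option V -> S :=
  fun o => if o is Some v then c v else s.

(** [All] and [Ex] bind the variable [None]. *)
Inductive formula (V : Type) (c : V -> S) : Type :=
| Bot
| Eq (s : S) (t u : term c s)
| Rel (p : psym Sig) (ts : forall i, term c (pred_args p i))
| Imp (a b : formula c)
| And (a b : formula c)
| Or (a b : formula c)
| All (s : S) (a : formula (extend c s))
| Ex (s : S) (a : formula (extend c s)).

Definition no_var (v : Empty_set) : S := match v with end.

Definition sentence := formula no_var.

Definition theory := sentence -> Prop.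

End Syntax.

Section Semantics.
Variable S : finType.

Record domain := Domain {
  carrier :> S -> Type;
  carrier_inhabited : forall s, inhabited (carrier s) }.

Record interp (Sig : signature S) (D : domain) := Interp {
  ifun : forall f : fsym Sig, (forall i, D (fun_args f i)) -> D (fres f);
  ipred : forall p : psym Sig, (forall i, D (pred_args p i)) -> Prop }.

Record structure (Sig : signature S) := Structure {
  dom : domain;
  str_interp : interp Sig dom }.

Variables (Sig : signature S) (D : domain) (I : interp Sig D).

Fixpoint eval (V : Type) (c : V -> S) (e : forall v, D (c v))
    (s : S) (t : term Sig c s) : D s :=
  match t with
  | Var v => e v
  | App f ts => ifun I (fun i => eval e (ts i))
  end.

Definition extend_val (V : Type) (c : V -> S) (e : forall v, D (c v))
    (s : S) (x : D s) : forall o, D (extend c s o) :=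
  fun o => match o with Some v => e v | None => x end.

Fixpoint holds (V : Type) (c : V -> S) (e : forall v, D (c v))
    (a : formula Sig c) : Prop :=
  match a with
  | Bot => False
  | Eq _ t u => eval e t = eval e u
  | Rel p ts => ipred I (fun i => eval e (ts i))
  | Imp a b => holds e a -> holds e b
  | And a b => holds e a /\ holds e b
  | Or a b => holds e a \/ holds e b
  | All s a => forall x : D s, holds (extend_val e x) a
  | Ex s a => exists x : D s, holds (extend_val e x) a
  end.

Definition no_val (v : Empty_set) : D (no_var S v) := match v with end.

End Semantics.

Definition models (S : finType) (Sig : signature S) (m : structure Sig)
    (a : sentence Sig) : Prop :=
  holds (str_interp m) (@no_val S (dom m)) a.

(** * Words and languages modulo a theory *)

Section Words.
Variables (S : finType) (Sig : signature S).

Definition in_models (T : theory Sig) (m : structure Sig) : Prop :=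
  (forall a, T a -> models m a) /\
  (forall s, exists f : dom m s -> nat, injective f).

(** Same sort domains and same interpretation of the rigid symbols. *)
Inductive rigid_agree : structure Sig -> structure Sig -> Prop :=
| RigidAgree (D : domain S) (I J : interp Sig D) :
    (forall f, frigid f -> ifun I (f:=f) = ifun J (f:=f)) ->
    (forall p, prigid p -> ipred I (p:=p) = ipred J (p:=p)) ->
    rigid_agree (Structure I) (Structure J).

Definition language := seq (structure Sig) -> Prop.

Definition is_word (T : theory Sig) : language := fun w =>
  (forall m, List.In m w -> in_models T m) /\
  (forall m1 m2, List.In m1 w -> List.In m2 w -> rigid_agree m1 m2).

Definition is_language (T : theory Sig) (L : language) : Prop :=
  forall w, L w -> is_word T w.

(** A concatenation of words need not be a word (domains and rigid symbols may
    change at the junctions), hence the first conjunct. *)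
Definition star (T : theory Sig) (L : language) : language := fun w =>
  is_word T w /\
  exists ws : seq (seq (structure Sig)),
    (forall u, List.In u ws -> L u) /\ w = flatten ws.

End Words.

(** * First-order automata *)

Section Automata.
Variable S : finType.

(** The union of [Gam], [Sig] and the primed copy of [Gam].  Disjointness of
    [Gam] and [Sig] is built in through the sum; only the non-rigid symbols of
    [Gam] get a primed copy, the rigid ones being shared. *)
Section TransSignature.
Variables Gam Sig : signature S.

Definition trans_fsym : finType :=
  (fsym Gam + fsym Sig + {f : fsym Gam | ~~ frigid f})%type.

Definition trans_psym : finType :=
  (psym Gam + psym Sig + {p : psym Gam | ~~ prigid p})%type.

Definition trans_fun_arity (f : trans_fsym) : nat :=
  match f with
  | inl (inl g) => fun_arity g
  | inl (inr h) => fun_arity h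
  | inr g => fun_arity (val g)
  end.

Definition trans_fun_args (f : trans_fsym) : 'I_(trans_fun_arity f) -> S :=
  match f with
  | inl (inl g) => fun_args g
  | inl (inr h) => fun_args h
  | inr g => fun_args (val g)
  end.

Definition trans_fres (f : trans_fsym) : S :=
  match f with
  | inl (inl g) => fres g | inl (inr h) => fres h | inr g => fres (val g)
  end.

Definition trans_pred_arity (p : trans_psym) : nat :=
  match p with
  | inl (inl g) => pred_arity g
  | inl (inr h) => pred_arity h
  | inr g => pred_arity (val g)
  end.

Definition trans_pred_args (p : trans_psym) : 'I_(trans_pred_arity p) -> S :=
  match p with
  | inl (inl g) => pred_args g
  | inl (inr h) => pred_args h
  | inr g => pred_args (val g)
  end.

Definition trans_frigid (f : trans_fsym) : bool :=
  match f with
  | inl (inl g) => frigid g | inl (inr h) => frigid h | inr _ => false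
  end.

Definition trans_prigid (p : trans_psym) : bool :=
  match p with
  | inl (inl g) => prigid g | inl (inr h) => prigid h | inr _ => false
  end.

Definition trans_sig : signature S :=
  Signature trans_fun_args trans_fres trans_pred_args trans_frigid trans_prigid.

(** The combined interpretation of rho, sigma and tau'.  It is only used when
    [I] and [K] agree on the rigid symbols of [Gam]. *)
Definition trans_interp (D : domain S) (I : interp Gam D) (J : interp Sig D)
    (K : interp Gam D) : interp trans_sig D :=
  @Interp S trans_sig D
    (fun f => match f return
         (forall i, D (trans_fun_args (f:=f) i)) -> D (trans_fres f) with
       | inl (inl g) => ifun I (f:=g)
       | inl (inr h) => ifun J (f:=h)
       | inr g => ifun K (f:=val g)
       end)
    (fun p => match p return
         (forall i, D (trans_pred_args (p:=p) i)) -> Prop with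
       | inl (inl g) => ipred I (p:=g)
       | inl (inr h) => ipred J (p:=h)
       | inr g => ipred K (p:=val g)
       end).

End TransSignature.

Record automaton (Sig : signature S) := Automaton {
  state_sig : signature S;
  init : sentence state_sig;
  trans : sentence (trans_sig state_sig Sig);
  final : sentence state_sig }.

Section Acceptance.
Variables (Sig : signature S) (A : automaton Sig).

Inductive step : structure (state_sig A) -> structure Sig ->
    structure (state_sig A) -> Prop :=
| Step (D : domain S) (I : interp (state_sig A) D) (J : interp Sig D)
    (K : interp (state_sig A) D) :
    models (Structure (trans_interp I J K)) (trans A) ->
    step (Structure I) (Structure J) (Structure K).

(** For the empty word the second clause is void: its runs are the single
    structures satisfying [init], whatever their domains. *)
Record is_run (w : seq (structure Sig)) (r : seq (structure (state_sig A))) :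
    Prop := IsRun {
  run_size : size r = (size w).+1;
  run_dom : forall sigma rho,
    onth w 0 = Some sigma -> List.In rho r -> dom rho = dom sigma;
  run_rigid : forall rho1 rho2,
    List.In rho1 r -> List.In rho2 r -> rigid_agree rho1 rho2;
  run_init : exists2 rho, onth r 0 = Some rho & models rho (init A);
  run_step : forall i rho sigma tau,
    onth r i = Some rho -> onth w i = Some sigma -> onth r i.+1 = Some tau ->
    step rho sigma tau }.

Definition accepts (w : seq (structure Sig)) : Prop :=
  exists2 r, is_run w r &
    exists2 rho, onth r (size w) = Some rho & models rho (final A).

Definition lang (T : theory Sig) : language Sig := fun w =>
  is_word T w /\ accepts w.

End Acceptance.

Definition regular (Sig : signature S) (T : theory Sig) (L : language Sig) :
    Prop :=
  exists A : automaton Sig, forall w, L w <-> lang A T w.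

End Automata.

(* Main.v *)
(** The star automaton carries two copies rho, tau of the state signature of [A]
    and a flag b.  Reading a letter simulates a transition of [A] from the current
    rho to the next tau; when the flag is down, rho has to equal tau, and when it
    is raised, a factor ends: tau is then final, and rho is a freshly guessed
    initial state.  Two copies are needed since a first-order transition formula
    cannot quantify over the final state of the factor being left.  All symbols
    become non-rigid, and the transition formula itself demands that the rigid
    symbols of [A] keep their value inside a factor.  The initial and final states
    are those with the flag raised, so the empty word is accepted in any case. *)

Require Import Defs.
From mathcomp Require Import all_boot.
From Stdlib Require Import FunctionalExtensionality PropExtensionality.
From Stdlib Require Eqdep Classical_Prop.

Set Implicit Arguments.
Unset Strict Implicit.
Unset Printing Implicit Defensive.

Definition ord0_rect (P : 'I_0 -> Type) (i : 'I_0) : P i :=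
  False_rect (P i) (notF (ltn_ord i)).

(** * First-order definable properties of interpretations *)

Section Definability.
Variable S : finType.

(** The sorted family [X] is left arbitrary so that the same operation builds tuples of terms and
    tuples of domain elements; evaluation then commutes with it by [ord_cons_map]. *)
Definition ord_cons n (a : 'I_n.+1 -> S) (X : S -> Type)
    (x : X (a ord0)) (y : forall i : 'I_n, X (a (lift ord0 i))) (i : 'I_n.+1) :
    X (a i) :=
  match unliftP ord0 i in unlift_spec _ _ o return X (a i) with
  | UnliftSome j e => eq_rect_r (fun k => X (a k)) (y j) e
  | UnliftNone e => eq_rect_r (fun k => X (a k)) x e
  end.

Lemma ord_cons_map n (a : 'I_n.+1 -> S) (X Y : S -> Type)
    (g : forall s, X s -> Y s) (x : X (a ord0)) y i :
  g _ (@ord_cons n a X x y i) = @ord_cons n a Y (g _ x) (fun j => g _ (y j)) i.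
Proof.
rewrite /ord_cons; case: (unliftP ord0 i) => [j e|e].
  by subst i.
by subst i.
Qed.

Lemma ord_cons_eta n (a : 'I_n.+1 -> S) (X : S -> Type)
    (x : forall i, X (a i)) :
  @ord_cons n a X (x ord0) (fun j => x (lift ord0 j)) = x.
Proof.
apply: functional_extensionality_dep => i.
by rewrite /ord_cons; case: (unliftP ord0 i) => [j e|e]; subst i.
Qed.

Variable G : signature S.

(** One formula has to serve all domains and interpretations. Keeping only its existence avoids
    writing out formulas over growing contexts. *)
Definition definable (V : Type) (c : V -> S)
    (P : forall D, interp G D -> (forall v, D (c v)) -> Prop) :=
  exists phi : formula G c, forall D I e, holds I e phi <-> P D I e.

Section Connectives.
Variables (V : Type) (c : V -> S).
Implicit Types P Q : forall D, interp G D -> (forall v, D (c v)) -> Prop.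

Lemma definable_ext P Q : (forall D I e, P D I e <-> Q D I e) ->
  definable P -> definable Q.
Proof.
move=> PQ [phi phiP]; exists phi => D I e.
by split=> [/phiP/PQ|/PQ/phiP].
Qed.

Lemma definable_and P Q : definable P -> definable Q ->
  definable (fun D I e => P D I e /\ Q D I e).
Proof.
by move=> [a aP] [b bP]; exists (And a b) => D I e /=; rewrite aP bP.
Qed.

Lemma definable_imp P Q : definable P -> definable Q ->
  definable (fun D I e => P D I e -> Q D I e).
Proof.
by move=> [a aP] [b bP]; exists (Imp a b) => D I e /=; rewrite aP bP.
Qed.

Lemma definable_false : definable (fun D I (e : forall v, D (c v)) => False).
Proof. by exists (Bot G c). Qed.

Lemma definable_forall_fin (X : finType)
    (P : X -> forall D, interp G D -> (forall v, D (c v)) -> Prop) :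
  (forall x, definable (P x)) -> definable (fun D I e => forall x, P x D I e).
Proof.
move=> Pdef.
suff [phi phiP] : definable (fun D I e => forall x, x \in enum X -> P x D I e).
  exists phi => D I e; rewrite phiP.
  by split=> H x => [|_]; apply: H; rewrite ?mem_enum.
elim: (enum X) => [|x s [phi phiP]].
  by exists (Imp (Bot G c) (Bot G c)) => D I e /=; split.
have [psi psiP] := Pdef x; exists (And psi phi) => D I e /=.
rewrite psiP phiP; split=> [[Hx Hs] y|H].
  by rewrite inE => /predU1P[->|/Hs].
by split=> [|y ys]; apply: H; rewrite inE ?eqxx ?ys ?orbT.
Qed.

Lemma definable_if (b : bool) P :
  definable P -> definable (fun D I e => b -> P D I e).
Proof.
case: b => [|_]; first by apply: definable_ext => D I e; split=> [//|]; apply.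
by exists (Imp (Bot G c) (Bot G c)) => D I e /=; split.
Qed.

End Connectives.

(* Quantifying over a whole argument tuple.  The parameters [e] of [P] hold the
   variables bound so far; asking for definability at arbitrary terms in place
   of [e] and [x] makes the induction on [n] go through. *)
Lemma definable_forall_tuple n (a : 'I_n -> S) (V : Type) (c : V -> S)
    (P : forall D, interp G D -> (forall v, D (c v)) ->
         (forall i, D (a i)) -> Prop) :
  (forall (W : Type) (d : W -> S) (us : forall v, term G d (c v))
      (ts : forall i, term G d (a i)),
    definable (fun D I (e : forall v, D (d v)) =>
      P D I (fun v => eval I e (us v)) (fun i => eval I e (ts i)))) ->
  definable (fun D I e => forall x, P D I e x).
Proof.
elim: n a V c P => [|n IH] a V c P Pdef.
  have [phi phiP] := Pdef V c (fun v => Var G c v) (ord0_rect _).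
  exists phi => D I e; rewrite phiP; split=> [H x|]; last exact.
  rewrite (_ : x = fun i => eval I e (ord0_rect (fun i => term G c (a i)) i)) //.
  by apply: functional_extensionality_dep => -[].
pose s0 := a ord0.
(* The first entry of the tuple becomes the parameter [None], bound by the outermost quantifier; the
   remaining [n] entries are left to the induction hypothesis. *)
pose Q D (I : interp G D) (e : forall o, D (extend c s0 o)) x :=
  P D I (fun v => e (Some v)) (@ord_cons n a D (e None) x).
have [phi phiP] : definable (fun D I e => forall x, Q D I e x).
  apply: IH => W d us ts.
  apply: definable_ext
    (Pdef W d (fun v => us (Some v)) (@ord_cons n a (term G d) (us None) ts)).
  move=> D I e; rewrite /Q.
  rewrite (_ : (fun i => eval I e (ord_cons _ _ i)) =
    @ord_cons n a D (eval I e (us None)) (fun i => eval I e (ts i))) //.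
  apply: functional_extensionality_dep => i.
  exact: (@ord_cons_map n a (term G d) D (eval I e)).
exists (All phi) => D I e /=; split=> [H x|H x].
  by have /phiP/(_ (fun j => x (lift ord0 j))) := H (x ord0);
    rewrite /Q /= ord_cons_eta.
by apply/phiP => y; apply: H.
Qed.

End Definability.

(** * Translating sentences along definable reducts *)

Section Reducts.
Variables (S : finType) (G H : signature S).

(* A reduct turning [H]-structures into [G]-structures on the same domain, each
   symbol of [G] being read as an [H]-term or atomic [H]-formula. *)
Record definable_reduct (red : forall D, interp H D -> interp G D) : Prop :=
  DefinableReduct {
  reduct_fun : forall (V : Type) (c : V -> S) (f : Defs.fsym G)
    (ts : forall i, term H c (fun_args f i)),
    exists t : term H c (fres f), forall D (I : interp H D) e,
      eval I e t = ifun (red D I) (fun i => eval I e (ts i));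
  reduct_pred : forall (V : Type) (c : V -> S) (p : psym G)
    (ts : forall i, term H c (pred_args p i)),
    definable (fun D (I : interp H D) (e : forall v, D (c v)) =>
      ipred (red D I) (fun i => eval I e (ts i))) }.

Section Translation.
Variable red : forall D, interp H D -> interp G D.
Hypothesis redP : definable_reduct red.

Lemma reduct_term (V : Type) (c : V -> S) s (t : term G c s) :
  exists u : term H c s, forall D (I : interp H D) e,
    eval I e u = eval (red I) e t.
Proof.
elim: t => [v|f ts /fin_all_exists[us usP]]; first by exists (Var H c v).
have [t tP] := reduct_fun redP us; exists t => D I e /=; rewrite tP.
by congr (ifun _ _); apply: functional_extensionality_dep => i; apply: usP.
Qed.

Lemma reduct_definable (V : Type) (c : V -> S) (a : formula G c) :
  definable (fun D (I : interp H D) e => holds (red I) e a).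
Proof.
elim: a => {V c} [V c|V c s t u|V c p ts|V c a [x xP] b [y yP]
  |V c a [x xP] b [y yP]|V c a [x xP] b [y yP]|V c s a [x xP]|V c s a [x xP]].
- by exists (Bot H c).
- have [t' t'P] := reduct_term t; have [u' u'P] := reduct_term u.
  by exists (Eq t' u') => D I e /=; rewrite t'P u'P.
- have [us usP] := fin_all_exists (fun i => reduct_term (ts i)).
  apply: definable_ext (reduct_pred redP us) => D I e /=.
  by rewrite (functional_extensionality_dep _ _ (fun i => usP i D I e)).
- by exists (Imp x y) => D I e /=; rewrite xP yP.
- by exists (And x y) => D I e /=; rewrite xP yP.
- by exists (Or x y) => D I e /=; rewrite xP yP.
- by exists (All x) => D I e /=; split=> h z; apply/xP.
- by exists (Ex x) => D I e /=; split=> -[z /xP hz]; exists z.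
Qed.

Lemma reduct_models_definable (a : sentence G) :
  definable (c:=no_var S) (fun D (I : interp H D) e =>
    models (Structure (red I)) a).
Proof.
apply: definable_ext (reduct_definable a) => D I e.
by rewrite (_ : e = @no_val S D) //; apply: functional_extensionality_dep.
Qed.

End Translation.

(** Stated argument by argument, not as equality of functions as in [rigid_agree], so that
    quantifiers over the arguments can express it. *)
Definition agree (Pf : pred (Defs.fsym G)) (Pp : pred (psym G)) (D : domain S)
    (I J : interp G D) : Prop :=
  (forall f, Pf f -> forall x, ifun I (f:=f) x = ifun J x) /\
  (forall p, Pp p -> forall x, ipred I (p:=p) x <-> ipred J x).

(** The signature is finite and each arity is finite, so a finite conjunction of universally
    quantified equations and equivalences suffices. *)
Lemma agree_definable (red1 red2 : forall D, interp H D -> interp G D) Pf Pp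
    (V : Type) (c : V -> S) :
  definable_reduct red1 -> definable_reduct red2 ->
  definable (fun D (I : interp H D) (e : forall v, D (c v)) =>
    agree Pf Pp (red1 D I) (red2 D I)).
Proof.
move=> r1P r2P; apply: definable_and.
  apply: definable_forall_fin => f; apply: definable_if.
  apply: definable_forall_tuple => W d us ts.
  have [t tP] := reduct_fun r1P ts; have [u uP] := reduct_fun r2P ts.
  by exists (Eq t u) => D I e /=; rewrite tP uP.
apply: definable_forall_fin => p; apply: definable_if.
apply: definable_forall_tuple => W d us ts.
have d1 := reduct_pred r1P ts; have d2 := reduct_pred r2P ts.
exact: definable_and (definable_imp d1 d2) (definable_imp d2 d1).
Qed.

End Reducts.

Lemma agree_eq (S : finType) (G : signature S) (D : domain S)
    (I J : interp G D) : agree predT predT I J -> I = J.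
Proof.
case: I J => [f p] [f' p'] [/= Ef Ep]; congr Interp.
  apply: functional_extensionality_dep => g.
  by apply: functional_extensionality_dep => x; apply: Ef.
apply: functional_extensionality_dep => q.
apply: functional_extensionality_dep => x.
by apply: propositional_extensionality; apply: Ep.
Qed.

Definition rigid_eq (S : finType) (G : signature S) (D : domain S) :
  interp G D -> interp G D -> Prop := agree frigid prigid (D:=D).

Lemma In_mapP (X Y : Type) (f : X -> Y) (s : seq X) y :
  List.In y (map f s) <-> exists x, f x = y /\ List.In x s.
Proof. exact: List.in_map_iff. Qed.

Lemma onth_last (X : Type) (x : X) s : onth (x :: s) (size s) = Some (last x s).
Proof. by elim: s x => //= y s IH x; rewrite -IH. Qed.

(** * Runs over a fixed domain *)

Section Runs.
Variables (S : finType) (Sig : signature S).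

(** Inverting [rigid_agree] and [step] at structures over a common domain yields equalities of
    dependent pairs; cancelling the domain rests on uniqueness of identity proofs. *)
Lemma Structure_inj (G : signature S) (D : domain S) :
  injective (@Structure S G D).
Proof. by move=> I J [=]; apply: Eqdep.EqdepTheory.inj_pair2. Qed.

Lemma Structure_of_dom (G : signature S) (D : domain S) (m : structure G) :
  dom m = D -> exists I : interp G D, m = Structure I.
Proof. by case: m => D' I /= eD; subst D'; exists I. Qed.

Lemma Structures_of_dom (G : signature S) (D : domain S)
    (w : seq (structure G)) :
  (forall m, List.In m w -> dom m = D) ->
  exists Is : seq (interp G D), w = map (@Structure S G D) Is.
Proof.
elim: w => [|m w IH] wD; first by exists [::].
have [I ->] := Structure_of_dom (wD m (or_introl erefl)).
have [Is ->] := IH (fun k kw => wD k (or_intror kw)).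
by exists (I :: Is).
Qed.

Lemma rigid_agreeP (G : signature S) (D : domain S) (I J : interp G D) :
  rigid_agree (Structure I) (Structure J) <-> rigid_eq I J.
Proof.
split=> [|[Ef Ep]]; last first.
  constructor=> [f fr|p pr]; apply: functional_extensionality_dep => x.
    exact: Ef.
  by apply: propositional_extensionality; apply: Ep.
move eI: (Structure I) => m1; move eJ: (Structure J) => m2 mm.
case: mm eI eJ => D' I' J' Ef Ep eI eJ.
have eD : D = D' by case: eI.
subst D'; move/Structure_inj: eI => ->; move/Structure_inj: eJ => ->.
by split=> [f fr|p pr] x; [rewrite (Ef f fr)|rewrite (Ep p pr)].
Qed.

Variable A : automaton Sig.
Notation G := (state_sig A).

Definition sat_init (D : domain S) (I : interp G D) :=
  models (Structure I) (init A).
Definition sat_final (D : domain S) (I : interp G D) :=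
  models (Structure I) (final A).
Definition sat_trans (D : domain S) (I : interp G D) J (K : interp G D) :=
  models (Structure (trans_interp I J K)) (trans A).

Lemma stepP (D : domain S) (I K : interp G D) (J : interp Sig D) :
  step (Structure I) (Structure J) (Structure K) <-> sat_trans I J K.
Proof.
split=> [|H]; last by constructor.
move eI: (Structure I) => m1; move eJ: (Structure J) => m2.
move eK: (Structure K) => m3 mm.
case: mm eI eJ eK => D' I' J' K' H eI eJ eK.
have eD : D = D' by case: eI.
subst D'; move/Structure_inj: eI => ->; move/Structure_inj: eJ => ->.
by move/Structure_inj: eK => ->.
Qed.

Fixpoint accepts_from (D : domain S) (I : interp G D)
    (w : seq (interp Sig D)) : Prop :=
  if w is J :: w' then
    exists K, [/\ rigid_eq I K, sat_trans I J K & accepts_from K w']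
  else sat_final I.

Lemma rigid_eq_trans (D : domain S) (I J K : interp G D) :
  rigid_eq I J -> rigid_eq J K -> rigid_eq I K.
Proof.
move=> [f1 p1] [f2 p2]; split=> [f fr|p pr] x.
  by rewrite f1 ?f2.
by rewrite p1 ?p2.
Qed.

Lemma rigid_eq_sym (D : domain S) (I J : interp G D) :
  rigid_eq I J -> rigid_eq J I.
Proof.
move=> [f1 p1]; split=> [f fr|p pr] x; first by rewrite f1.
by rewrite p1.
Qed.

Lemma rigid_eq_refl (D : domain S) (I : interp G D) : rigid_eq I I.
Proof. by split. Qed.

(** Rigid agreement of neighbours spreads along the run by transitivity; conversely, two states that
    agree with the first agree with each other. *)
Lemma accepts_fromP (D : domain S) (I : interp G D) (w : seq (interp Sig D)) :
  accepts_from I w <-> exists Ks : seq (interp G D),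
    [/\ size Ks = size w, forall K, List.In K Ks -> rigid_eq I K,
      forall i K J K', onth (I :: Ks) i = Some K -> onth w i = Some J ->
        onth (I :: Ks) i.+1 = Some K' -> sat_trans K J K'
    & sat_final (last I Ks)].
Proof.
elim: w I => [|J w IH] I /=.
  split=> [fI|[Ks [/size0nil-> //]]].
  by exists [::]; split=> // i K J K1; rewrite onth0n.
split=> [[K [rIK tr /IH[Ks [sz rg st fn]]]]|[Ks []]]; last first.
  case: Ks => // K Ks [sz] rg st fn.
  exists K; split; [by apply: rg; left|exact: (st 0)|].
  apply/IH; exists Ks; split=> // [K' K'Ks|i]; last exact: (st i.+1).
  by apply: rigid_eq_trans (rg K' (or_intror K'Ks)); apply: rigid_eq_sym;
    apply: rg; left.
exists (K :: Ks); split=> //=; first by rewrite sz.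
  by move=> K' [<- //|/rg]; apply: rigid_eq_trans.
by case=> [|i] K1 J1 K2 /=; [move=> [<-] [<-] [<-]|apply: st].
Qed.

Lemma accepts_intro (D : domain S) (I : interp G D) (w : seq (interp Sig D)) :
  sat_init I -> accepts_from I w -> accepts A (map (@Structure S Sig D) w).
Proof.
move=> iI /accepts_fromP[Ks [sz rg st fn]].
exists (map (@Structure S G D) (I :: Ks)).
  split.
  - by rewrite /= !size_map sz.
  - case: w {sz st} => [//|J w] sigma rho [<-] /In_mapP[K [<- _]].
    by [].
  - have rgI K : List.In K (I :: Ks) -> rigid_eq I K.
      by case=> [<-|/rg //]; apply: rigid_eq_refl.
    move=> rho1 rho2 /In_mapP[K [<- /rgI rK]]
      /In_mapP[K' [<- /rgI rK']].
    by apply/rigid_agreeP; apply: rigid_eq_trans rK'; apply: rigid_eq_sym.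
  - by exists (Structure I).
  move=> i rho sigma tau; rewrite !onth_map.
  case e1: (onth (I :: Ks) i) => [K|//] [<-].
  case e2: (onth w i) => [J|//] [<-].
  case e3: (onth (I :: Ks) i.+1) => [K'|//] [<-].
  by apply/stepP; apply: st e1 e2 e3.
exists (Structure (last I Ks)) => //.
by rewrite size_map -sz onth_map onth_last.
Qed.

(** The word is nonempty because its first letter is what forces the states of the run onto the
    domain [D]. *)
Lemma accepts_elim (D : domain S) (J : interp Sig D) (w : seq (interp Sig D)) :
  accepts A (map (@Structure S Sig D) (J :: w)) ->
  exists2 I : interp G D, sat_init I & accepts_from I (J :: w).
Proof.
case=> r [sz rD rg [rho0 r0 i0] st] [rho rn fn].
have [Ks er] := @Structures_of_dom G D r (fun m => rD _ m erefl).
subst r; case: Ks sz {rD} rg r0 st rn => [//|I Ks] sz rg [e0] st rn.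
subst rho0; exists I => //; apply/accepts_fromP; exists Ks; split.
- by case: sz; rewrite !size_map.
- move=> K KKs.
  by apply/rigid_agreeP; apply: rg; [left|right; apply/In_mapP; exists K].
- move=> i K J' K' e1 e2 e3; apply/stepP; apply: (st i).
  + by rewrite onth_map e1.
  + by rewrite onth_map e2.
  + by rewrite onth_map e3.
case: sz rn; rewrite !size_map => szKs; rewrite -[size _]/(size w).+1 -szKs.
by rewrite onth_map onth_last => -[e]; subst rho.
Qed.

End Runs.

(** * States of the star automaton *)

Section PairSignature.
Variables (S : finType) (G : signature S).

(* Two copies of [G] and a nullary predicate [None].  No symbol is rigid, as the
   rigid symbols of [G] may change from one factor of the word to the next. *)
Definition pair_fsym : finType := (Defs.fsym G + Defs.fsym G)%type.
Definition pair_psym : finType := option (psym G + psym G).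

Definition unpair_fsym (f : pair_fsym) : Defs.fsym G :=
  match f with inl g => g | inr g => g end.

Definition pair_pred_arity (p : pair_psym) : nat :=
  match p with
  | Some (inl q) => pred_arity q
  | Some (inr q) => pred_arity q
  | None => 0
  end.

Definition pair_pred_args (p : pair_psym) : 'I_(pair_pred_arity p) -> S :=
  match p with
  | Some (inl q) => pred_args q
  | Some (inr q) => pred_args q
  | None => ord0_rect (fun=> S)
  end.

Definition pair_sig : signature S :=
  @Signature S pair_fsym pair_psym _ (fun f => fun_args (unpair_fsym f))
    (fun f => fres (unpair_fsym f)) _ pair_pred_args pred0 pred0.

Variable D : domain S.

Definition pair_interp (I J : interp G D) (b : Prop) : interp pair_sig D :=
  @Interp S pair_sig D
    (fun f => match f return
         (forall i, D (fun_args (unpair_fsym f) i)) -> D (fres (unpair_fsym f))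
       with
       | inl g => ifun I (f:=g)
       | inr g => ifun J (f:=g)
       end)
    (fun p => match p return
         (forall i, D (pair_pred_args (p:=p) i)) -> Prop with
       | Some (inl q) => ipred I (p:=q)
       | Some (inr q) => ipred J (p:=q)
       | None => fun=> b
       end).

Definition fst_interp (K : interp pair_sig D) : interp G D :=
  Interp (fun f => ifun K (f:=inl f)) (fun p => ipred K (p:=Some (inl p))).

Definition snd_interp (K : interp pair_sig D) : interp G D :=
  Interp (fun f => ifun K (f:=inr f)) (fun p => ipred K (p:=Some (inr p))).

Definition flag (K : interp pair_sig D) : Prop :=
  ipred K (p:=None) (ord0_rect _).

Lemma fst_pair_interp I J b : fst_interp (pair_interp I J b) = I.
Proof. by case: I. Qed.

Lemma snd_pair_interp I J b : snd_interp (pair_interp I J b) = J.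
Proof. by case: J. Qed.

End PairSignature.

Lemma inhabited_interp (S : finType) (G : signature S) (D : domain S) :
  inhabited (interp G D).
Proof.
have [s|d _] := @fin_all_exists S D (fun s x => True).
  by case: (carrier_inhabited D s) => x; exists x.
by constructor; apply: Interp => [f _|p _]; [apply: d|exact: False].
Qed.

(** * The transition sentence of the star automaton *)

Section StarAutomaton.
Variables (S : finType) (Sig : signature S) (A : automaton Sig).
Notation G := (state_sig A).
Notation G2 := (pair_sig G).
Notation H := (trans_sig G2 Sig).

Section TransReducts.
Variables (D : domain S) (M : interp H D).

Definition pre_interp : interp G2 D :=
  @Interp S G2 D (fun f => ifun M (f:=inl (inl f)))
    (fun p => ipred M (p:=inl (inl p))).

Definition word_interp : interp Sig D :=
  @Interp S Sig D (fun f => ifun M (f:=inl (inr f)))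
    (fun p => ipred M (p:=inl (inr p))).

(** As [G2] has no rigid symbols, each of its symbols has a primed copy, with [isT] as the proof of
    non-rigidity. *)
Definition post_interp : interp G2 D :=
  @Interp S G2 D
    (fun f => ifun M (f:=inr (exist (fun f => ~~ frigid f) f isT)))
    (fun p => ipred M (p:=inr (exist (fun p => ~~ prigid p) p isT))).

End TransReducts.

Lemma pre_trans_interp D (K : interp G2 D) J K' :
  pre_interp (trans_interp K J K') = K.
Proof. by case: K. Qed.

Lemma word_trans_interp D (K : interp G2 D) J K' :
  word_interp (trans_interp K J K') = J.
Proof. by case: J. Qed.

Lemma post_trans_interp D (K : interp G2 D) J K' :
  post_interp (trans_interp K J K') = K'.
Proof. by case: K'. Qed.

(* A state is a triple (rho, tau, b): rho is the source of the next transition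
   of [A], tau the target of the previous one, and [b] says that the word read
   so far is a product of words of the language.  Hence rho = tau unless [b],
   in which case rho is a fresh initial state. *)
Definition star_step D (K : interp G2 D) (J : interp Sig D) K' : Prop :=
  ((flag K -> sat_init (fst_interp K)) /\
   ((flag K -> False) -> agree predT predT (fst_interp K) (snd_interp K))) /\
  ((rigid_eq (fst_interp K) (snd_interp K') /\
    sat_trans (fst_interp K) J (snd_interp K')) /\
   (flag K' -> sat_final (snd_interp K'))).

Lemma fst_pre_reduct :
  definable_reduct (fun D (M : interp H D) => fst_interp (pre_interp M)).
Proof.
split=> V c x ts.
  by exists (@App S H V c (inl (inl (inl x))) ts).
by exists (@Rel S H V c (inl (inl (Some (inl x)))) ts).
Qed.

Lemma snd_pre_reduct :
  definable_reduct (fun D (M : interp H D) => snd_interp (pre_interp M)).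
Proof.
split=> V c x ts.
  by exists (@App S H V c (inl (inl (inr x))) ts).
by exists (@Rel S H V c (inl (inl (Some (inr x)))) ts).
Qed.

Lemma snd_post_reduct :
  definable_reduct (fun D (M : interp H D) => snd_interp (post_interp M)).
Proof.
split=> V c x ts.
  by exists (@App S H V c
    (inr (exist (fun f : Defs.fsym G2 => ~~ frigid f) (inr x) isT)) ts).
by exists (@Rel S H V c
  (inr (exist (fun p : psym G2 => ~~ prigid p) (Some (inr x)) isT)) ts).
Qed.

(** A transition of [A] is read off a transition of the star automaton: its source is the first copy
    before the letter, its target the second copy after it. *)
Lemma trans_reduct :
  definable_reduct (fun D (M : interp H D) =>
    trans_interp (fst_interp (pre_interp M)) (word_interp M)
      (snd_interp (post_interp M))).
Proof.
split=> V c [[x|x]|[x nr]] ts.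
- exact: (reduct_fun fst_pre_reduct).
- by exists (@App S H V c (inl (inr x)) ts).
- exact: (reduct_fun snd_post_reduct).
- exact: (reduct_pred fst_pre_reduct).
- by exists (@Rel S H V c (inl (inr x)) ts).
- exact: (reduct_pred snd_post_reduct).
Qed.

Lemma definable_pre_flag (V : Type) (c : V -> S) :
  definable (fun D (M : interp H D) (e : forall v, D (c v)) =>
    flag (pre_interp M)).
Proof.
exists (@Rel S H V c (inl (inl None)) (ord0_rect _)) => D M e /=.
rewrite /flag /=.
rewrite (_ : (fun i => eval M e (ord0_rect _ i)) = ord0_rect _) //.
by apply: functional_extensionality_dep => -[].
Qed.

Lemma definable_post_flag (V : Type) (c : V -> S) :
  definable (fun D (M : interp H D) (e : forall v, D (c v)) =>
    flag (post_interp M)).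
Proof.
exists (@Rel S H V c
  (inr (exist (fun p : psym G2 => ~~ prigid p) None isT)) (ord0_rect _)).
move=> D M e /=; rewrite /flag /=.
rewrite (_ : (fun i => eval M e (ord0_rect _ i)) = ord0_rect _) //.
by apply: functional_extensionality_dep => -[].
Qed.

Lemma definable_flag (V : Type) (c : V -> S) :
  definable (fun D (K : interp G2 D) (e : forall v, D (c v)) => flag K).
Proof.
exists (@Rel S G2 V c None (ord0_rect _)) => D K e /=.
rewrite /flag /=.
rewrite (_ : (fun i => eval K e (ord0_rect _ i)) = ord0_rect _) //.
by apply: functional_extensionality_dep => -[].
Qed.

Lemma definable_sentence (G' : signature S)
    (P : forall D, interp G' D -> Prop) :
  definable (c:=no_var S) (fun D I e => P D I) ->
  exists a : sentence G', forall D (I : interp G' D),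
    models (Structure I) a <-> P D I.
Proof. by case=> a aP; exists a => D I; apply: aP. Qed.

Lemma star_step_sentence :
  exists a : sentence H, forall D (K K' : interp G2 D) J,
    models (Structure (trans_interp K J K')) a <-> star_step K J K'.
Proof.
have [a aP] : exists a : sentence H, forall D (M : interp H D),
    models (Structure M) a <->
    star_step (pre_interp M) (word_interp M) (post_interp M).
  apply: definable_sentence; apply: definable_and; apply: definable_and;
    [| |apply: definable_and|].
  - apply: definable_imp; first exact: definable_pre_flag.
    exact: (reduct_models_definable fst_pre_reduct).
  - apply: definable_imp.
      exact: definable_imp (definable_pre_flag _) (definable_false _ _).
    exact: (agree_definable _ _ _ fst_pre_reduct snd_pre_reduct).
  - exact: (agree_definable _ _ _ fst_pre_reduct snd_post_reduct).
  - exact: (reduct_models_definable trans_reduct).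
  - apply: definable_imp; first exact: definable_post_flag.
    exact: (reduct_models_definable snd_post_reduct).
exists a => D K K' J; rewrite aP.
by rewrite pre_trans_interp word_trans_interp post_trans_interp.
Qed.

Lemma star_automaton_exists :
  exists (fl : sentence G2) (tr : sentence H),
    let B := Automaton fl tr fl in
    [/\ forall D (K : interp (state_sig B) D), sat_init K <-> flag K,
        forall D (K : interp (state_sig B) D), sat_final K <-> flag K &
        forall D (K : interp (state_sig B) D) J K',
          sat_trans K J K' <-> star_step K J K'].
Proof.
have [fl flP] := definable_sentence (definable_flag (no_var S)).
have [tr trP] := star_step_sentence.
by exists fl, tr; split=> // D K J K'; apply: trP.
Qed.

(** * From runs to factorizations and back *)

Section StarRuns.
Variables (fl : sentence G2) (tr : sentence H).
Let B := Automaton fl tr fl.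
Hypothesis finalP :
  forall D (K : interp (state_sig B) D), sat_final K <-> flag K.
Hypothesis transP : forall D (K : interp (state_sig B) D) J K',
  sat_trans K J K' <-> star_step K J K'.
Variable D : domain S.
Implicit Types (w u v : seq (interp Sig D)) (K : interp (state_sig B) D).

Definition accepted w := exists2 I : interp G D, sat_init I & accepts_from I w.

Definition factored w :=
  exists2 ws, forall u, List.In u ws -> accepted u & w = flatten ws.

(** Induction needs a claim for states inside a factor too: there [u] is the rest of the current
    factor, up to the next raised flag. Finality at a raised flag is a premise since it is
    guaranteed by the transition into [K], which is not part of the run from [K]. *)
Lemma star_run_factored K w : accepts_from K w ->
  (flag K -> factored w) /\
  exists u v, [/\ w = u ++ v, factored v &
    (flag K -> sat_final (snd_interp K)) -> accepts_from (snd_interp K) u].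
Proof.
have f0 : factored [::] by exists [::].
elim: w K => [|J w IH] K /=.
  move=> /finalP fK; split=> //; exists [::], [::]; split=> //=.
  exact.
case=> K' [_ /transP[[bI nb] [[rg st] bF]] /IH[_ [u [v [-> fv]]]]].
move=> /(_ bF) acc'.
have acc : accepts_from (fst_interp K) (J :: u) by exists (snd_interp K').
have star_w : flag K -> factored (J :: u ++ v).
  case: fv => ws wsP -> /bI iK; exists ((J :: u) :: ws) => // x [<-|/wsP //].
  by exists (fst_interp K).
split=> //; have [bK|nK] := Classical_Prop.classic (flag K).
  (* With the flag raised the previous factor is already complete, so nothing of it remains to be
     read. *)
  exists [::], (J :: u ++ v); split=> //; [exact: star_w|exact].
exists (J :: u), v; split=> // _.
by rewrite -(agree_eq (nb nK)).
Qed.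

(* Quantifying over [I'] leaves the second component free, so that a preceding
   factor can store its last state there. *)
Definition restartable w :=
  exists I : interp G D, forall I' : interp G D,
    accepts_from (pair_interp I I' True : interp (state_sig B) D) w.

(** Inside [u] both copies follow the run of [A] with the flag down; when [u] is exhausted the flag
    goes up and the first copy jumps to the state provided for [v]. *)
Lemma restart_run (I : interp G D) u v : accepts_from I u -> restartable v ->
  exists (I0 : interp G D) (b : Prop), (b -> sat_final I) /\
    accepts_from (pair_interp I0 I b : interp (state_sig B) D) (u ++ v).
Proof.
move=> acc [I0 I0P]; elim: u I acc => [|J u IH] I /=.
  by move=> fI; exists I0, True; split.
case=> I1 [rg st /IH[I2 [b [bF acc]]]].
exists I, False; split=> //.
exists (pair_interp I2 I1 b); split=> //.
by apply/transP; rewrite /star_step !fst_pair_interp !snd_pair_interp.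
Qed.

Lemma restartable_nil : restartable [::].
Proof.
have [I] := inhabited_interp G D.
by exists I => I'; apply/finalP.
Qed.

(** The transition out of a flagged state constrains only its first copy, so [I'] may be
    arbitrary. *)
Lemma restartable_cat J u v :
  accepted (J :: u) -> restartable v -> restartable ((J :: u) ++ v).
Proof.
case=> I iI [I1 [rg st acc1]] rv.
have [I2 [b [bF acc]]] := restart_run acc1 rv.
exists I => I'; exists (pair_interp I2 I1 b); split=> //.
apply/transP; rewrite /star_step !fst_pair_interp !snd_pair_interp.
by split=> //; split=> // /(_ Logic.I).
Qed.

End StarRuns.

End StarAutomaton.

(** * Regularity of the star *)

Lemma In_flatten (X : Type) (ws : seq (seq X)) u x :
  List.In u ws -> List.In x u -> List.In x (flatten ws).
Proof.
elim: ws => //= v ws IH [<-|uws] xu; apply: List.in_or_app; first by left.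
by right; apply: IH.
Qed.

Lemma is_word_dom (S : finType) (Sig : signature S) (T : theory Sig) m w :
  is_word T (m :: w) -> exists (D : domain S) (Js : seq (interp Sig D)),
    m :: w = map (@Structure S Sig D) Js.
Proof.
case=> _ agr; exists (dom m); apply: Structures_of_dom => k kw.
by case: (agr _ _ (or_introl erefl) kw).
Qed.

Theorem theorem5 (S : finType) (Sig : signature S) (T : theory Sig)
    (L : language Sig) (hL : is_language T L) (hreg : regular T L) :
  regular T (star T L).
Proof.
have [A AP] := hreg.
have [fl [tr [initP finalP transP]]] := star_automaton_exists A.
exists (Automaton fl tr fl) => w.
split=> [[wT [ws [wsL ew]]]|[wT acc]]; split=> //.
- suff main (D : domain S) (Js : seq (interp Sig D)) :
      w = map (@Structure S Sig D) Js -> accepts (Automaton fl tr fl) w.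
    case: w wT {ew} main => [_ main|m w wT main].
      (* The empty word determines no domain; one-element sorts serve. *)
      exact: (main (@Domain S (fun=> unit) (fun=> inhabits tt)) [::]).
    by have [D [Js eJs]] := is_word_dom wT; apply: main eJs.
  move=> eJs; rewrite eJs.
  have [I IP] : restartable fl tr Js.
    move: eJs; rewrite {}ew => {w wT} eJs.
    elim: ws Js wsL eJs => [|u ws IH] Js wsL /=.
      by case: Js => // _; apply: restartable_nil.
    move=> eJs.
    have eu : u = map (@Structure S Sig D) (take (size u) Js).
      by rewrite map_take -eJs take_size_cat.
    have ews : flatten ws = map (@Structure S Sig D) (drop (size u) Js).
      by rewrite map_drop -eJs drop_size_cat.
    have {ews} := IH _ (fun v vws => wsL v (or_intror vws)) ews.
    have [_] := iffLR (AP u) (wsL u (or_introl erefl)).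
    rewrite {1}eu -{3}(cat_take_drop (size u) Js).
    (* An empty factor is dropped: it adds no letter, and the claim is then the induction
       hypothesis. *)
    case: (take _ _) => [//|J Js'] /accepts_elim[I iI acc].
    by apply: restartable_cat => //; exists I.
  by apply: accepts_intro (IP I); apply/initP.
case: w wT acc => [|m w] wT acc; first by exists [::].
have [D [[//|J Js] eJs]] := is_word_dom wT.
move: wT acc; rewrite eJs => wT /accepts_elim[K /initP fK].
move=> /(star_run_factored finalP transP)[/(_ fK)[ws wsP eJJs] _].
exists (map (map (@Structure S Sig D)) ws); split; last first.
  by rewrite eJJs map_flatten.
move=> _ /In_mapP[v [<- vws]]; apply/AP; split.
  (* A factor inherits being a word from the whole, as its letters occur there. *)
  have sub m' : List.In m' (map (@Structure S Sig D) v) ->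
      List.In m' (map (@Structure S Sig D) (J :: Js)).
    move=> /In_mapP[I [<- Iv]]; apply/In_mapP; exists I; split=> //.
    by rewrite eJJs; apply: In_flatten Iv.
  by case: wT => wT1 wT2; split=> [m1 /sub|m1 m2 /sub m1w /sub]; auto.
by have [I iI acc'] := wsP v vws; apply: accepts_intro acc'.
Qed.
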